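(* Let $K$ be a field, $1\le d\le n$, let $I=I_{n,d}\subset S=K[x_1,\dots,x_n]$ be the ideal generated by all squarefree monomials of degree $d$, and let $J\subset T=S[y_1,\dots,y_m]$ be the defining ideal of the symbolic Rees algebra $\mathcal{R}_s(I)$. Then the initial ideal $\mathrm{in}_<(J)$ with respect to the monomial order on $T$ defined in the context is generated by monomials of the form $x_iy_j$, $y_jy_k$, and $x_iy_jy_k$.
   Context: $I^{(k)}=\bigcap_{P\in\mathrm{Ass}(I)}(I^kS_P\cap S)$ is the $k$th symbolic power and $\mathcal{R}_s(I)=\bigoplus_{k\ge0}I^{(k)}t^k\subset S[t]$. Let $w_1,\dots,w_m$ be the minimal monomial generators of $\mathcal{R}_s(I)$ as an $S$-algebra, labelled so that $w_1>\dots>w_m$, where $ut^p>vt^q$ iff $p>q$, or $p=q$ and $u>_{\mathrm{lex}}v$ (lexicographic order on $S$ with $x_1>\dots>x_n$). (It is known that $\mathcal{R}_s(I)$ is generated over $S$ by the monomials $x_{i_1}\cdots x_{i_{q+d-1}}t^q$ with $1\le q\le n-d+1$, $i_1<\dots<i_{q+d-1}$.) Let $\varphi:T\to\mathcal{R}_s(I)$ be the $S$-algebra map with $\varphi(y_i)=w_i$; the defining ideal is $J=\mathrm{Ker}\,\varphi$. Order on $T$: let $>_{\mathrm{rlex}}$ be the (degree) reverse lexicographic order on $K[y_1,\dots,y_m]$ with $y_1>\dots>y_m$. For monomials $g,g'$ in the $y$'s and $f,f'$ in the $x$'s, $gf>g'f'$ iff $g>_{\mathrm{rlex}}g'$, or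 $g=g'$ and $f>_{\mathrm{lex}}f'$. The indices in the monomials $y_jy_k$ and $x_iy_jy_k$ are allowed to satisfy $j=k$. *)

(* Defs.v *)
From mathcomp Require Export all_boot all_order all_algebra.
From mathcomp Require Export classical_sets.
From mathcomp Require Export mpoly.

#[export] Set Implicit Arguments.
#[export] Unset Strict Implicit.
#[export] Unset Printing Implicit Defensive.

Import GRing.Theory.

Local Open Scope classical_set_scope.
Local Open Scope ring_scope.

Section Ideals.
Variable R : comNzRingType.
Implicit Types I P G : set R.

Definition is_ideal I : Prop :=
  [/\ I 0, forall a b, I a -> I b -> I (a + b) & forall r a, I a -> I (r * a)].

Definition ideal_gen G : set R := smallest is_ideal G.

Definition is_prime_ideal P : Prop :=
  [/\ is_ideal P, ~ P 1 & forall a b, P (a * b) -> P a \/ P b].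

(* The associated primes of the R-module R / I: the primes which are the
   annihilator (I : a) of the class of some a. *)
Definition Ass I : set (set R) :=
  [set P | is_prime_ideal P /\ exists a, P = [set r | I (r * a)]].

Fixpoint ideal_pow I (k : nat) : set R :=
  if k is k'.+1 then
    ideal_gen [set c | exists a b, [/\ I a, ideal_pow I k' b & c = a * b]]
  else setT.

(* J R_P \cap R, the contraction to R of the extension of J to the
   localization at P; J is meant to be an ideal and P a prime ideal. *)
Definition loc_contraction (P J : set R) : set R :=
  [set f | exists s, ~ P s /\ J (s * f)].

Definition symbolic_pow I (k : nat) : set R :=
  \bigcap_(P in Ass I) loc_contraction P (ideal_pow I k).

(* A polynomial over R is an element of R[t]. *)
Definition symbolic_rees I : set {poly R} :=
  [set f | forall k, symbolic_pow I k f`_k].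

Definition is_subalgebra (A : set {poly R}) : Prop :=
  [/\ forall c : R, A c%:P, forall f g, A f -> A g -> A (f + g)
    & forall f g, A f -> A g -> A (f * g)].

Definition algebra_gen (W : set {poly R}) : set {poly R} :=
  smallest is_subalgebra W.

Definition is_minimal_generating_set (A W : set {poly R}) : Prop :=
  algebra_gen W = A /\ forall V, V `<=` W -> algebra_gen V = A -> V = W.

End Ideals.

Section Orders.
Variable n : nat.
Implicit Types u v : 'X_{1..n}.

(* In the orders below, index 0 is the largest variable, and "lt" takes the
   smaller monomial first. *)
Definition lex_lt v u : Prop :=
  exists i : 'I_n, (v i < u i)%N /\ forall j : 'I_n, (j < i)%N -> v j = u j.

Definition rlex_lt v u : Prop :=
  (mdeg v < mdeg u)%N \/
  mdeg v = mdeg u /\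
  exists i : 'I_n, (u i < v i)%N /\ forall j : 'I_n, (i < j)%N -> v j = u j.

(* The pair (u, p) stands for the monomial u t^p of S[t]. *)
Definition xt_lt (b a : 'X_{1..n} * nat) : Prop :=
  (b.2 < a.2)%N \/ b.2 = a.2 /\ lex_lt b.1 a.1.

End Orders.

(* The pair (g, f) stands for the monomial g f of T, with g in the y's and f in
   the x's. *)
Definition yx_lt (m n : nat) (b a : 'X_{1..m} * 'X_{1..n}) : Prop :=
  rlex_lt b.1 a.1 \/ b.1 = a.1 /\ lex_lt b.2 a.2.

Section SymbolicReesVeronese.
Variables (K : fieldType) (n : nat).

(* mechar d u: u has degree d and all its exponents are at most 1. *)
Definition sqfree_veronese (d : nat) : set {mpoly K[n]} :=
  ideal_gen [set f | exists u : 'X_{1..n}, mechar d u /\ f = 'X_[u]].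

Definition xt_mon (a : 'X_{1..n} * nat) : {poly {mpoly K[n]}} :=
  'X_[a.1] *: 'X^(a.2).

Variable m : nat.

Local Notation T := {mpoly {mpoly K[n]}[m]}.

Definition xvar (i : 'I_n) : T := ('X_i : {mpoly K[n]})%:MP.
Definition yvar (j : 'I_m) : T := 'X_j.

Definition yx_mon (c : 'X_{1..m} * 'X_{1..n}) : T :=
  ('X_[c.2] : {mpoly K[n]}) *: 'X_[c.1].

(* mmap h w F substitutes w i for 'X_i in F and applies h to the coefficients:
   here, the S-algebra map T -> S[t] sending y_i to w_i. *)
Definition defining_ideal (w : 'I_m -> 'X_{1..n} * nat) : set T :=
  [set F | mmap (@polyC {mpoly K[n]}) (fun i => xt_mon (w i)) F = 0].

Definition is_initial_monomial (F : T) (c : 'X_{1..m} * 'X_{1..n}) : Prop :=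
  F@_c.1@_c.2 != 0 /\
  forall b : 'X_{1..m} * 'X_{1..n}, F@_b.1@_b.2 != 0 -> b = c \/ yx_lt b c.

Definition initial_ideal (J : set T) : set T :=
  ideal_gen [set M | exists F c,
    [/\ J F, is_initial_monomial F c & M = yx_mon c]].

End SymbolicReesVeronese.

Arguments sqfree_veronese K n d _ : clear implicits.
Arguments xt_mon K {n} a.
Arguments xvar K {n} m i.
Arguments yvar K n {m} j.
Arguments defining_ideal K {n m} w _.

(* Main.v *)
Require Import Defs.
From mathcomp Require Import zify.
From mathcomp Require boolp.

(** The symbolic Rees algebra is spanned by monomials u t^k, and J is a toric
    ideal: it is the kernel of a map sending every monomial g f of T (g in the
    y's, f in the x's) to a monomial u t^k, which is called its image below.  The
    monomials with a given image form a fibre.  If g f is the initial monomial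
    of an element of J, then a second, smaller monomial of the same fibre must
    occur in that element for the image to cancel; conversely a difference of two
    monomials of one fibre lies in J.  Hence in(J) is spanned by the monomials
    that are not minimal in their fibre ([initial_nonmin], [nonmin_initial]), and
    the claim is that a monomial all of whose divisors of shape x_i y_j, y_j y_k
    or x_i y_j y_k are minimal in their fibres is itself minimal
    ([nonmin_small]).

    The first task is to identify the w_j.  For a squarefree u with support U put
    q = |U| - d + 1.  When d >= 2 the minimal generators are all the u t^q with
    |U| >= d; when d = 1 they are the x_i t only, since then u t^q is a product
    of q of these.  For every Z with d - 1 elements, the prime generated by the
    variables outside Z is associated to I, and the order along it of a
    polynomial is the least degree of its monomials in those variables.  So every
    monomial v t^k of the symbolic Rees algebra has degree at least k in the
    variables outside Z, for each Z ([symbolic_rees_symb]).  The monomials u t^q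
    above do lie in the algebra ([gen_symbolic]), they generate all monomials
    satisfying these inequalities ([symb_generated]), and they are indecomposable
    among these ([gen_indecomposable]); the last point forces each of them into
    any monomial generating set ([gen_in_w]), and minimality excludes all other
    monomials ([w_in_gen]).

    Write U_j for the support of w_j, and let g f have only minimal small
    divisors.  For d >= 2, three exchanges inside a fibre describe such monomials
    ([locmin_std]): the sets U_j that occur in g form a chain, because y_j y_k
    can be replaced by a single variable if U_j and U_k share fewer than d
    elements, and by the variables of union and intersection otherwise; an x_i
    dividing f belongs to the larger set of any two factors of g; and for each
    factor either i is in U_j or i precedes all of U_j, since otherwise an
    earlier element of U_j could be exchanged for i.  For d = 1 only the last
    condition remains.  A monomial satisfying these conditions is determined by
    its image v t^k: if k > 0, the largest set of the chain must consist of the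
    last min(k + d - 1, |supp v|) elements of supp v (of the last one if d = 1),
    see [std_top]; dividing by the corresponding variable and repeating recovers
    g, and then f.  So each fibre contains at most one such monomial
    ([std_uniq]).  The minimum of the fibre is one, since all its divisors are
    minimal in their fibres; hence g f is this minimum. *)

Import GRing.Theory.

(** * Supports and squarefree monomials *)

Lemma sub_card_ex (T : finType) (A : {set T}) q : q <= #|A| ->
  exists2 B : {set T}, B \subset A & #|B| = q.
Proof.
exists [set x in take q (enum A)].
  by apply/fintype.subsetP=> x; rewrite inE => /mem_take; rewrite mem_enum.
rewrite cardsE; have /card_uniqP -> := take_uniq q (enum_uniq A).
by rewrite size_takel // -cardE.
Qed.

Lemma super_card_ex n (U : {set 'I_n}) q : #|U| <= q <= n ->
  exists2 Z : {set 'I_n}, U \subset Z & #|Z| = q.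
Proof.
case/andP=> Uq qn; have [|B Bs Bc] := @sub_card_ex _ (~: U) (q - #|U|).
  by have := cardsC U; rewrite card_ord; lia.
exists (U :|: B); first exact: finset.subsetUl.
rewrite cardsU; have -> : U :&: B = finset.set0.
  by apply/eqP; rewrite setI_eq0 disjoint_sym finset.disjoints_subset.
by rewrite cards0 Bc; lia.
Qed.

Definition msupport n (v : 'X_{1..n}) : {set 'I_n} := [set i | 0 < v i].

Lemma mnm1_le k (v : 'X_{1..k}) i : (U_(i) <= v)%MM = (0 < v i).
Proof. by rewrite lep1mP lt0n. Qed.

Lemma mdeg_gt0 k (g : 'X_{1..k}) : 0 < mdeg g -> exists j, 0 < g j.
Proof.
by rewrite mdegE lt0n sum_nat_eq0 => /forallPn[j]; rewrite implyTb -lt0n; exists j.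
Qed.

Lemma mesym1_in n (U : {set 'I_n}) i : mesym1 U i = (i \in U).
Proof. by rewrite mnmE. Qed.

Section Combinatorics.
Variables (n d : nat).
Implicit Types (U V : {set 'I_n}).

(** The second clause reflects that for d = 1 the symbolic powers are ordinary
    powers, so that only the degree-one monomials are indecomposable. *)
Definition is_gen U := (d <= #|U|) && ((d == 1) ==> (#|U| == 1)).
Definition gen_mon U : 'X_{1..n} * nat := (mesym1 U, #|U|.+1 - d).

Lemma gen_mon_inj : injective gen_mon.
Proof. by move=> U V /(congr1 fst) /inj_mesym1. Qed.

End Combinatorics.

(** * The monomial orders *)

Lemma lex_lt_asym n (u v : 'X_{1..n}) : lex_lt u v -> lex_lt v u -> False.
Proof.
move=> [i [lti eqi]] [j [ltj eqj]].
case: (ltngtP i j) => [ij|ji|/val_inj ij].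
- by move: (eqj _ ij) lti; lia.
- by move: (eqi _ ji) ltj; lia.
- by move: ij ltj lti => ->; lia.
Qed.

Lemma xt_lt_asym n (a b : 'X_{1..n} * nat) : xt_lt a b -> xt_lt b a -> False.
Proof.
case=> [h1|[h1 l1]] [h2|[h2 l2]]; try lia.
exact: lex_lt_asym l1 l2.
Qed.

Lemma rlex_lt_irr n (u : 'X_{1..n}) : ~ rlex_lt u u.
Proof. by case=> [|[_ [i []]]]; rewrite ltnn. Qed.

Lemma rlex_lt_trans n (v u t : 'X_{1..n}) :
  rlex_lt u v -> rlex_lt v t -> rlex_lt u t.
Proof.
case=> [h|[e [i [h hi]]]] [h'|[e' [i' [h' hi']]]].
- by left; lia.
- by left; lia.
- by left; lia.
right; split; first lia.
case: (ltngtP i i') => [ii|ii|/val_inj ii].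
- exists i'; split; first by rewrite hi.
  by move=> j ij; rewrite hi ?hi' //; lia.
- exists i; split; first by rewrite -hi'.
  by move=> j ij; rewrite hi ?hi' //; lia.
- subst i'; exists i; split; first lia.
  by move=> j ij; rewrite hi ?hi' //; lia.
Qed.

Lemma rlex_lt_add n (h u v : 'X_{1..n}) :
  rlex_lt u v -> rlex_lt (h + u)%MM (h + v)%MM.
Proof.
case=> [l|[e [i [l hi]]]]; first by left; rewrite !mdegD; lia.
right; split; first by rewrite !mdegD e.
exists i; split; first by rewrite !mnmDE; lia.
by move=> j ij; rewrite !mnmDE hi.
Qed.

(** Everything below a monomial has at most its degree, so lies in a finite set;
    the number of monomials below decreases strictly along the order. *)
Lemma rlex_wf n : well_founded (@rlex_lt n).
Proof.
move=> g; move: {2}(mdeg g) (leqnn (mdeg g)) => D.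
pose below (h : 'X_{1..n}) :=
  [set b : 'X_{1..n < D.+1} | boolp.asbool (rlex_lt (bmnm b) h)].
move: {2}#|below g| (leqnn #|below g|) => N.
elim: N => [|N IH] in g *; move=> gN gD; constructor=> h hg;
  have hD : mdeg h < D.+1 by move: hg => [|[]]; lia.
  move: gN; rewrite leqn0 => /eqP/cards0_eq/finset.setP/(_ (BMultinom hD)).
  by rewrite !inE boolp.asboolT.
apply: IH => //; rewrite -ltnS; apply: leq_trans gN; apply: proper_card.
apply/properP; split; last first.
  exists (BMultinom hD); rewrite inE; first exact: boolp.asboolT.
  by apply/negP=> /boolp.asboolW; exact: rlex_lt_irr.
apply/fintype.subsetP=> b; rewrite !inE => bh; exact: rlex_lt_trans bh hg.
Qed.

(** In fixed degree, a monomial becomes smaller by using a variable of larger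
    index: this is the form in which the reverse lexicographic order is used. *)
Lemma rlex_lt_last n (u v : 'X_{1..n}) (b : 'I_n) :
    mdeg u = mdeg v -> 0 < u b -> (forall i : 'I_n, b < i -> u i = 0) ->
    (forall i : 'I_n, b <= i -> v i = 0) ->
  rlex_lt u v.
Proof.
move=> e ub ui vi; right; split=> //; exists b; split; first by rewrite vi.
by move=> j bj; rewrite ui ?vi // ltnW.
Qed.

(** * Fibres of the monomial map, and their minima *)

Section Toric.
Variables (n d m : nat) (w : 'I_m -> 'X_{1..n} * nat) (u : 'I_m -> {set 'I_n}).
Hypothesis wE : forall j, w j = gen_mon d (u j).
Hypothesis u_gen : forall j, is_gen d (u j).
Hypothesis gen_u : forall U, is_gen d U -> exists j, u j = U.
Hypothesis w_sorted : forall i j : 'I_m, i < j -> xt_lt (w j) (w i).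

Local Notation bimon := ('X_{1..m} * 'X_{1..n})%type.
Implicit Types (c : bimon) (g : 'X_{1..m}) (f : 'X_{1..n}).

Lemma w1E j l : (w j).1 l = (l \in u j).
Proof. by rewrite wE mesym1_in. Qed.

Lemma w2E j : (w j).2 = #|u j|.+1 - d.
Proof. by rewrite wE. Qed.

Lemma u_card j : d <= #|u j|.
Proof. by case/andP: (u_gen j). Qed.

(** The strict decrease of the w_j excludes repetitions. *)
Lemma u_inj : injective u.
Proof.
move=> i j e; have {e}: w i = w j by rewrite !wE e.
case: (ltngtP i j) => [ij|ij|/val_inj//] e; have := w_sorted ij; rewrite e => h;
  by case: (xt_lt_asym h h).
Qed.

Lemma xt_lt_w i j : xt_lt (w j) (w i) -> i < j.
Proof.
move=> h; rewrite ltnNge; apply/negP; rewrite leq_eqVlt => /orP[/eqP/val_inj e|].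
  by subst j; case: (xt_lt_asym h h).
by move/w_sorted => h'; case: (xt_lt_asym h h').
Qed.

(** A pair (g, f) stands for the monomial g f of T; [phi_mon] is the exponent of
    its image in S[t] under the substitution of w_j for y_j. *)
Definition phi_mon c : 'X_{1..n} * nat :=
  ((c.2 + \sum_j (w j).1 *+ c.1 j)%MM, \sum_j (w j).2 * c.1 j).

Definition bimon_mul c c' : bimon := ((c.1 + c'.1)%MM, (c.2 + c'.2)%MM).

Lemma phi_mon_mul c c' :
  phi_mon (bimon_mul c c') =
    (((phi_mon c).1 + (phi_mon c').1)%MM, (phi_mon c).2 + (phi_mon c').2).
Proof.
congr pair => /=; last first.
  by rewrite -big_split; apply: eq_bigr => j _; rewrite mnmDE mulnDr.
apply/mnmP=> l; rewrite !mnmDE !mnm_sumE addnACA; congr (_ + _).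
by rewrite -big_split; apply: eq_bigr => j _ /=; rewrite !mulmnE mnmDE mulnDr.
Qed.

Lemma phi_mon_x f : phi_mon (0%MM, f) = (f, 0).
Proof.
congr pair => /=; last by rewrite big1 // => j _; rewrite mnm0E muln0.
by rewrite big1 ?addm0 // => j _; rewrite mnm0E.
Qed.

Lemma phi_mon_y j : phi_mon (U_(j)%MM, 0%MM) = w j.
Proof.
rewrite [RHS]surjective_pairing; congr pair => /=.
  rewrite add0m (bigD1 j) //= big1 ?addm0 => [|i /negbTE ij].
    by rewrite mnm1E eqxx.
  by rewrite mnm1E eq_sym ij.
rewrite (bigD1 j) //= big1 ?addn0 => [|i /negbTE ij].
  by rewrite mnm1E eqxx muln1.
by rewrite mnm1E eq_sym ij muln0.
Qed.

Lemma phi_mon_yx j f : phi_mon (U_(j)%MM, f) = ((f + (w j).1)%MM, (w j).2).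
Proof.
have := phi_mon_mul (0%MM, f) (U_(j)%MM, 0%MM).
by rewrite phi_mon_x phi_mon_y /bimon_mul /= add0m addm0.
Qed.

Lemma phi_mon_yyx j k f :
  phi_mon ((U_(j) + U_(k))%MM, f) = ((f + ((w j).1 + (w k).1))%MM, (w j).2 + (w k).2).
Proof.
have := phi_mon_mul (U_(j)%MM, f) (U_(k)%MM, 0%MM).
by rewrite phi_mon_y phi_mon_yx /bimon_mul /= addm0 addmA.
Qed.

Definition nonminimal c := exists c', phi_mon c' = phi_mon c /\ yx_lt c' c.

(** The order is compatible with multiplication, so non-minimality in the fibre
    passes to multiples. *)
Lemma nonmin_mul c c' : nonminimal c -> nonminimal (bimon_mul c' c).
Proof.
case=> b [e l]; exists (bimon_mul c' b); split; first by rewrite !phi_mon_mul e.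
case: l => [l|[e1 l]]; first by left; exact: rlex_lt_add.
right; split; first by rewrite /= e1.
case: l => i [h hi]; exists i; rewrite /= !mnmDE; split; first lia.
by move=> j ij; rewrite !mnmDE hi.
Qed.

Definition small_shape c :=
  [\/ exists i j, c = (U_(j)%MM, U_(i)%MM),
      exists j k, c = ((U_(j) + U_(k))%MM, 0%MM)
    | exists i j k, c = ((U_(j) + U_(k))%MM, U_(i)%MM)].

Definition locally_minimal c :=
  forall c' b, c = bimon_mul c' b -> small_shape b -> ~ nonminimal b.

Lemma min_locmin c : ~ nonminimal c -> locally_minimal c.
Proof. by move=> nc c' b e _ /(nonmin_mul c'); rewrite -e. Qed.

(** The combinatorial form of a monomial whose small divisors are all minimal in
    their fibres.  Taking j = k in [std_xy] is legitimate only when y_j^2 divides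
    g, which is what the divisibility hypothesis says. *)
Record standard c : Prop := Std {
  std_x : forall i j, 0 < c.2 i -> 0 < c.1 j ->
    i \in u j \/ forall l, l \in u j -> i < l;
  std_y : 1 < d -> forall j k, (U_(j) + U_(k) <= c.1)%MM ->
    (u j \subset u k) || (u k \subset u j);
  std_xy : 1 < d -> forall i j k, 0 < c.2 i -> (U_(j) + U_(k) <= c.1)%MM ->
    u j \subset u k -> i \in u k }.

Lemma locmin_dvd c b : locally_minimal c -> small_shape b ->
    (b.1 <= c.1)%MM -> (b.2 <= c.2)%MM ->
  ~ nonminimal b.
Proof.
move=> cmin bs b1 b2; apply: (cmin ((c.1 - b.1)%MM, (c.2 - b.2)%MM)) => //.
by rewrite /bimon_mul /= !submK // -surjective_pairing.
Qed.

Lemma rlex_lt_pair (a b j k : 'I_m) : a <= b -> j < b -> k < b ->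
  rlex_lt (U_(a) + U_(b))%MM (U_(j) + U_(k))%MM.
Proof.
move=> ab jb kb; apply: (@rlex_lt_last _ _ _ b).
- by rewrite !mdegD !mdeg1.
- by rewrite mnmDE !mnm1E eqxx addn1.
- by move=> i bi; rewrite mnmDE !mnm1E -!val_eqE /=; lia.
- by move=> i bi; rewrite mnmDE !mnm1E -!val_eqE /=; lia.
Qed.

Lemma rlex_lt_single (a j : 'I_m) : j < a -> rlex_lt U_(a)%MM U_(j)%MM.
Proof.
move=> ja; apply: (@rlex_lt_last _ _ _ a).
- by rewrite !mdeg1.
- by rewrite !mnm1E eqxx.
- by move=> i bi; rewrite !mnm1E -!val_eqE /=; lia.
- by move=> i bi; rewrite !mnm1E -!val_eqE /=; lia.
Qed.

(** The y-degree dominates the order, so y_j y_k f is not minimal as soon as the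
    fibre contains a monomial with a single y: the t-degrees of w_j and w_k add
    up to that of a squarefree monomial with |U_j| + |U_k| + 1 - d variables. *)
Lemma nonmin_merge j k f (W : {set 'I_n}) : 1 < d ->
    (W \subset [set l | 0 < f l + (l \in u j) + (l \in u k)]) ->
    #|W| = #|u j| + #|u k| + 1 - d ->
  nonminimal ((U_(j) + U_(k))%MM, f).
Proof.
move=> d1 Wsub Wcard.
have Wgen : is_gen d W.
  by rewrite /is_gen; move: (u_card j) (u_card k); rewrite (_ : d == 1 = false); lia.
have [a ua] := gen_u Wgen.
exists (U_(a)%MM, (f + ((w j).1 + (w k).1) - mesym1 W)%MM); split; last first.
  by left; left; rewrite /= mdegD !mdeg1.
rewrite phi_mon_yx phi_mon_yyx !w2E ua.
congr pair; last by move: (u_card j) (u_card k); lia.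
apply/mnmP=> l; rewrite !(mnmDE, mnmBE) !w1E mesym1_in ua.
move/fintype.subsetP/(_ l): Wsub; rewrite inE.
by case: (l \in W) => [/(_ isT)|_]; lia.
Qed.

(** Each condition holds because its failure allows an exchange within the fibre
    that makes a small divisor smaller. *)
Lemma locmin_std c : locally_minimal c -> standard c.
Proof.
move=> cmin; split.
  (* If l in U_j precedes i, trade x_i y_j for x_l times the variable of the
     lexicographically smaller set with i in place of l. *)
- move=> i j fi gj; case: (boolP (i \in u j)) => [|iNu]; [by left|right=> l lu].
  rewrite ltnNge leq_eqVlt; apply/negP=> /orP[/eqP/val_inj e|li].
    by move: iNu; rewrite -e lu.
  have iNul : i \notin u j :\ l by rewrite inE negb_and iNu orbT.
  have ucard1 := cardsD1 l (u j); rewrite lu in ucard1.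
  have [a ua] : exists a, u a = i |: u j :\ l.
    by apply: gen_u; have := u_gen j; rewrite /is_gen cardsU1 iNul ucard1.
  have ucard : #|u a| = #|u j|.
    by rewrite ua cardsU1 iNul ucard1.
  apply: (@locmin_dvd c (U_(j)%MM, U_(i)%MM)) => //=; rewrite ?mnm1_le //.
    by constructor 1; exists i, j.
  exists (U_(a)%MM, U_(l)%MM); split.
    rewrite !phi_mon_yx !w2E ucard; congr pair.
    apply/mnmP => t; rewrite !mnmDE !w1E !mnm1E ua !inE.
    case: (eqVneq t l) => [->|tl]; first by rewrite lu /= orbF addnC eq_sym.
    rewrite [i == t]eq_sym /=.
    by case: (eqVneq t i) => // ->; rewrite (negbTE iNu).
  left; apply: rlex_lt_single; apply: xt_lt_w; right; rewrite !w2E ucard; split=> //.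
  exists l; rewrite !w1E ua lu !inE eqxx; split.
    by rewrite -val_eqE /= (ltn_eqF li).
  move=> t tl; rewrite !w1E ua !inE -!val_eqE.
  by rewrite (ltn_eqF tl) (ltn_eqF (ltn_trans tl li)).
  (* Incomparable U_j and U_k either merge into one generator or, when their
     intersection is large enough to carry a generator, are replaced by union and
     intersection; the intersection has smaller t-degree than both. *)
- move=> d1 j k gjk; apply/negPn/negP; rewrite negb_or => /andP[njk nkj].
  have dF : (d == 1) = false by lia.
  apply: (@locmin_dvd c ((U_(j) + U_(k))%MM, 0%MM)) => //=.
    + by constructor 2; exists j, k.
    + by apply/mnm_lepP=> i; rewrite mnm0E.
  have cUI := cardsUI (u j) (u k).
  case: (ltnP #|u j :&: u k| d) => h.
    have [|W Ws Wc] := @sub_card_ex _ (u j :|: u k) (#|u j| + #|u k| + 1 - d).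
      by lia.
    apply: (nonmin_merge d1 _ Wc); apply: (fintype.subset_trans Ws).
    apply/fintype.subsetP=> l; rewrite !inE mnm0E.
    by case: (l \in u j); case: (l \in u k).
  have [b ub] : exists b, u b = u j :&: u k.
    by apply: gen_u; rewrite /is_gen dF andbT.
  have [a ua] : exists a, u a = u j :|: u k.
    apply: gen_u; rewrite /is_gen dF andbT.
    exact: leq_trans (u_card j) (subset_leq_card (finset.subsetUl _ _)).
  have lj : #|u j :&: u k| < #|u j|.
    apply: proper_card; rewrite fintype.properE finset.subsetIl /=; apply: contra njk.
    by move/fintype.subset_trans; apply; exact: finset.subsetIr.
  have lk : #|u j :&: u k| < #|u k|.
    apply: proper_card; rewrite fintype.properE finset.subsetIr /=; apply: contra nkj.
    by move/fintype.subset_trans; apply; exact: finset.subsetIl.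
  exists ((U_(a) + U_(b))%MM, 0%MM); split.
    rewrite !phi_mon_yyx !w2E ua ub; congr pair; last by lia.
    apply/mnmP=> l; rewrite !mnmDE !w1E ua ub !inE.
    by case: (l \in u j); case: (l \in u k).
  left; apply: rlex_lt_pair.
  + apply: ltnW; apply: xt_lt_w; left; rewrite !w2E ua ub; lia.
  + apply: xt_lt_w; left; rewrite !w2E ub; lia.
  + apply: xt_lt_w; left; rewrite !w2E ub; lia.
  (* If i is outside U_k, it can be added to U_k; this raises the t-degree by
     one, which is compensated by merging (if |U_j| = d) or by moving an element
     of U_j to the x-part. *)
- move=> d1 i j k fi gjk ujk; apply/negPn/negP=> iNk.
  have dF : (d == 1) = false by lia.
  have iNj : i \notin u j by apply: contra iNk; apply/fintype.subsetP.
  apply: (@locmin_dvd c ((U_(j) + U_(k))%MM, U_(i)%MM)) => //=; rewrite ?mnm1_le //.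
    by constructor 3; exists i, j, k.
  have cle := subset_leq_card ujk.
  case: (ltnP d #|u j|) => h; last first.
    have e : #|u j| = d by move: (u_card j); lia.
    apply: (@nonmin_merge _ _ _ (i |: u k)) => //; last first.
      by rewrite cardsU1 iNk e; lia.
    apply/fintype.subsetP=> l; rewrite !inE mnm1E eq_sym.
    by case: eqP => //= _ ->; lia.
  have [l lu] : exists l, l \in u j by apply/card_gt0P; lia.
  have ucard := cardsD1 l (u j); rewrite lu in ucard.
  have [b ub] : exists b, u b = u j :\ l.
    by apply: gen_u; rewrite /is_gen dF andbT; lia.
  have [a ua] : exists a, u a = i |: u k.
    by apply: gen_u; rewrite /is_gen dF andbT cardsU1 iNk; move: (u_card k); lia.
  have acard : #|u a| = #|u k|.+1 by rewrite ua cardsU1 iNk.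
  rewrite -ub in ucard.
  exists ((U_(a) + U_(b))%MM, U_(l)%MM); split.
    rewrite !phi_mon_yyx !w2E acard ucard; congr pair; last by lia.
    apply/mnmP=> t; rewrite !mnmDE !w1E !mnm1E ua ub !inE.
    rewrite [i == t]eq_sym.
    case: (eqVneq t l) => [->|_]; case: (eqVneq _ i) => [e|_] //=.
    + by rewrite -e lu in iNj.
    + by rewrite lu; case: (l \in u k).
    + by rewrite e (negbTE iNk) (negbTE iNj).
    + by case: (t \in u j); case: (t \in u k).
  left; apply: rlex_lt_pair.
  + apply: ltnW; apply: xt_lt_w; left; rewrite !w2E; lia.
  + apply: xt_lt_w; left; rewrite !w2E; lia.
  + apply: xt_lt_w; left; rewrite !w2E; lia.
Qed.

Lemma peel c j : 0 < c.1 j -> c = bimon_mul (U_(j)%MM, 0%MM) ((c.1 - U_(j))%MM, c.2).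
Proof.
by move=> gj; rewrite /bimon_mul /= add0m addmC submK ?mnm1_le // -surjective_pairing.
Qed.

Lemma phi_mon_peel c j : 0 < c.1 j ->
  phi_mon c = (((w j).1 + (phi_mon ((c.1 - U_(j))%MM, c.2)).1)%MM,
           (w j).2 + (phi_mon ((c.1 - U_(j))%MM, c.2)).2).
Proof. by move=> gj; rewrite {1}(peel gj) phi_mon_mul phi_mon_y. Qed.

Lemma u_supp c j l : 0 < c.1 j -> l \in u j -> 0 < (phi_mon c).1 l.
Proof. by move=> gj lu; rewrite (phi_mon_peel gj) /= mnmDE w1E lu. Qed.

Lemma suppP c l : 0 < (phi_mon c).1 l ->
  0 < c.2 l \/ exists2 j, 0 < c.1 j & l \in u j.
Proof.
rewrite /= mnmDE; case: (posnP (c.2 l)) => [-> /=|]; last by left.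
rewrite mnm_sumE lt0n sum_nat_eq0 => /forallPn[j]; rewrite implyTb mulmnE w1E.
by case: (boolP (l \in u j)) => // lu; rewrite mul1n -lt0n; right; exists j.
Qed.

Hypothesis d_gt0 : 0 < d.

Lemma w2_gt0 j : 0 < (w j).2.
Proof. by rewrite w2E subn_gt0 ltnS u_card. Qed.

Lemma mdeg_phi_mon c : mdeg c.1 <= (phi_mon c).2.
Proof. by rewrite mdegE /=; apply: leq_sum => j _; rewrite leq_pmull ?w2_gt0. Qed.

Lemma phi_mon0 c : (phi_mon c).2 = 0 -> c = (0%MM, (phi_mon c).1).
Proof.
move=> e; have := mdeg_phi_mon c; rewrite e leqn0 mdeg_eq0 => /eqP g0.
by rewrite {2}(surjective_pairing c) g0 phi_mon_x -g0 -surjective_pairing.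
Qed.

(** The set of the largest generator in the standard monomial with image a: the
    last so many elements of the support, as the third clause says. *)
Definition is_top (a : 'X_{1..n} * nat) (U : {set 'I_n}) : Prop :=
  [/\ U \subset msupport a.1,
      #|U| = (if d == 1 then 1 else minn (a.2 + d.-1) #|msupport a.1|) &
      forall i l, 0 < a.1 i -> i \notin U -> l \in U -> i < l].

Lemma is_top_uniq a U V : is_top a U -> is_top a V -> U = V.
Proof.
case=> Us Uc Ut [Vs Vc Vt]; have UV : #|U| = #|V| by rewrite Uc Vc.
apply/eqP; rewrite eqEcard UV leqnn andbT.
apply/negPn/negP=> /subsetPn[x xU xV].
have : ~~ (V \subset U).
  apply/negP=> VU; have /eqP e : V == U by rewrite eqEcard VU UV leqnn.
  by rewrite e xU in xV.
case/subsetPn=> y yV yU.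
have xa : 0 < a.1 x by move/fintype.subsetP/(_ _ xU): Us; rewrite inE.
have ya : 0 < a.1 y by move/fintype.subsetP/(_ _ yV): Vs; rewrite inE.
by have := Ut _ _ ya yU xU; have := Vt _ _ xa xV yV; lia.
Qed.

(** The image of a standard monomial determines the largest set of its chain.
    With a single factor y_j, all of f outside U_j precedes U_j, so U_j is an
    end segment of the support.  With two or more factors the largest U_j
    contains all other sets and the support of f, so it is the whole support;
    the other factors make k large enough for the minimum to be |supp|. *)
Lemma std_top c : standard c -> 0 < (phi_mon c).2 ->
  exists2 j, 0 < c.1 j & is_top (phi_mon c) (u j).
Proof.
move=> cs k0; have [j0 gj0] : exists j, 0 < c.1 j.
  apply: mdeg_gt0; rewrite lt0n mdeg_eq0; apply/eqP=> g0.
  by move: k0; rewrite (surjective_pairing c) g0 phi_mon_x.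
have usub j : 0 < c.1 j -> u j \subset msupport (phi_mon c).1.
  by move=> gj; apply/fintype.subsetP=> l lu; rewrite inE (u_supp gj).
case: (eqVneq d 1) => d1.
  (* For d = 1 the sets are singletons, and the last variable of the support has
     to occur in g: if it occurs in f, it cannot precede any factor. *)
  have [l1 l1u] : exists l, l \in u j0 by apply/card_gt0P; move: (u_card j0); lia.
  have l1s := u_supp gj0 l1u.
  pose l := [arg max_(l > l1 | 0 < (phi_mon c).1 l) (l : nat)].
  have [ls lmax] : 0 < (phi_mon c).1 l /\ forall i, 0 < (phi_mon c).1 i -> i <= l.
    by rewrite /l; case: arg_maxnP.
  have [j gj lu] : exists2 j, 0 < c.1 j & l \in u j.
    case: (suppP ls) => // fl; exists j0 => //.
    case: (std_x cs fl gj0) => // /(_ _ l1u); have := lmax _ l1s; lia.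
  have uc : #|u j| = 1 by have := u_gen j; rewrite /is_gen d1 eqxx /= => /andP[_ /eqP].
  exists j => //; split; [exact: usub|by rewrite d1|].
  move=> i l' ia iNu; have /cards1P [x ux] : #|u j| == 1 by rewrite uc.
  move: lu iNu; rewrite ux !inE => /eqP <- il /eqP ->.
  by rewrite ltn_neqAle lmax // andbT.
have dF : 1 < d by lia.
have [j gj jmax] : exists2 j, 0 < c.1 j & forall i, 0 < c.1 i -> #|u i| <= #|u j|.
  case: (@arg_maxnP _ j0 (fun j => 0 < c.1 j) (fun j => #|u j|) gj0) => j gj jmax.
  by exists j.
exists j => //; have ucj := u_card j.
pose h := (c.1 - U_(j))%MM; have hE : c.1 = (U_(j) + h)%MM.
  by rewrite addmC submK // mnm1_le.
case: (posnP (mdeg h)) => [/eqP|/mdeg_gt0[k hk]].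
  rewrite mdeg_eq0 => /eqP h0; move: hE; rewrite h0 addm0 => cj.
  have fE : phi_mon c = ((c.2 + (w j).1)%MM, (w j).2).
    by rewrite (surjective_pairing c) cj phi_mon_yx.
  split; [exact: usub| |].
    have /subset_leq_card := usub j gj.
    have -> : (phi_mon c).2 = #|u j|.+1 - d by rewrite fE /= w2E.
    by rewrite (negbTE d1); lia.
  move=> i l ia iNu lu; case: (suppP ia) => [fi|[k]].
    by case: (std_x cs fi gj) => [iu|]; [rewrite iu in iNu|apply].
  by rewrite cj mnm1E lt0b => /eqP <-; rewrite (negbTE iNu).
have jk k' : 0 < h k' -> (U_(j) + U_(k') <= c.1)%MM.
  move=> hk'; rewrite hE; apply/mnm_lepP=> t; rewrite !mnmDE leq_add2l.
  by apply/mnm_lepP; rewrite mnm1_le.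
have kj k' : 0 < h k' -> (U_(k') + U_(j) <= c.1)%MM by rewrite addmC; exact: jk.
have ukj k' : 0 < h k' -> u k' \subset u j.
  move=> hk'; case/orP: (std_y cs dF (jk _ hk')) => // ujk'.
  have gk' : 0 < c.1 k' by rewrite hE mnmDE; lia.
  have /eqP -> // : u j == u k' by rewrite eqEcard ujk' jmax.
have suppE : msupport (phi_mon c).1 = u j.
  apply/eqP; rewrite finset.eqEsubset usub // andbT; apply/fintype.subsetP=> l.
  rewrite inE => /suppP[fl|[k' gk' lu]].
    exact: (std_xy cs dF fl (kj _ hk) (ukj _ hk)).
  case: (eqVneq j k') => [->//|jk'].
  have /ukj/fintype.subsetP -> // : 0 < h k'.
  by move: gk'; rewrite hE mnmDE mnm1E (negbTE jk').
split; [exact: usub| |].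
  rewrite (negbTE d1) suppE; suff : #|u j| < (phi_mon c).2 + d.-1 by lia.
  have := w2_gt0 k; rewrite (phi_mon_peel gj) -/h (@phi_mon_peel (h, c.2) k hk) /=.
  by move: (\sum_(_ < m) _) => s; rewrite (w2E j); move: #|u j| (w k).2 ucj; lia.
move=> i l ia; have : i \in msupport (phi_mon c).1 by rewrite inE.
by rewrite suppE => ->.
Qed.

Lemma std_peel c j : standard c -> standard ((c.1 - U_(j))%MM, c.2).
Proof.
have le k : (c.1 - U_(j))%MM k <= c.1 k by rewrite mnmBE leq_subr.
have leP a : (a <= c.1 - U_(j))%MM -> (a <= c.1)%MM.
  by move/lepm_trans; apply; exact: lem_subr.
case=> cx cy cxy; split=> /=.
- by move=> i k fi gk; apply: (cx i k fi); exact: leq_trans gk (le k).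
- by move=> d1 i k /leP; exact: cy.
- by move=> d1 i k l fi /leP; exact: cxy.
Qed.

(** Both monomials contain the variable of the same set, namely the one read off
    from the common image by [std_top]; divide by it and repeat. *)
Lemma std_uniq c c' : standard c -> standard c' -> phi_mon c = phi_mon c' -> c = c'.
Proof.
move: {2}(mdeg c.1) (leqnn (mdeg c.1)) => r.
elim: r => [|r IH] in c c' *; move=> cr cs cs' e.
  have ck : (phi_mon c).2 = 0.
    move: cr; rewrite leqn0 mdeg_eq0 => /eqP g0.
    by rewrite (surjective_pairing c) g0 phi_mon_x.
  by rewrite (phi_mon0 ck) (@phi_mon0 c') -e.
case: (posnP (phi_mon c).2) => [ck|ck].
  by rewrite (phi_mon0 ck) (@phi_mon0 c') -e.
have [j gj jt] := std_top cs ck.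
have [j' gj' jt'] : exists2 j, 0 < c'.1 j & is_top (phi_mon c') (u j).
  by apply: std_top => //; rewrite -e.
have ej : j' = j by apply: u_inj; apply: is_top_uniq jt' _; rewrite -e.
rewrite {}ej {jt' j'} in gj'.
have : ((c.1 - U_(j))%MM, c.2) = ((c'.1 - U_(j))%MM, c'.2).
  apply: IH; [|exact: std_peel|exact: std_peel|].
    by move: cr; rewrite {1}(peel gj) /= mdegD mdeg1.
  move: e; rewrite (phi_mon_peel gj) (phi_mon_peel gj') => e.
  rewrite [LHS]surjective_pairing [RHS]surjective_pairing.
  move: (congr1 fst e) (congr1 snd e) => /= e1 e2; congr pair.
    exact: addmI e1.
  exact: addnI e2.
by move=> ee; rewrite (peel gj) (peel gj') ee.
Qed.

(** Within a fibre the y-part determines the x-part, so the tie-breaking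
    comparison of the x-parts never applies. *)
Lemma yx_lt_phi_mon b c : phi_mon b = phi_mon c -> yx_lt b c -> rlex_lt b.1 c.1.
Proof.
move=> e [//|[e1 [i [l _]]]]; move/(congr1 fst)/mnmP/(_ i): e.
by rewrite /= !mnmDE !mnm_sumE e1; lia.
Qed.

Lemma phi_mon_min c :
  exists b, [/\ phi_mon b = phi_mon c, ~ nonminimal b & b = c \/ rlex_lt b.1 c.1].
Proof.
move: {2}c.1 (erefl c.1) => g; elim/(well_founded_ind (@rlex_wf m)): g c => g IH c cg.
case: (boolp.pselect (nonminimal c)) => [[c' [e l]]|cn]; last first.
  by exists c; split=> //; left.
have l' := yx_lt_phi_mon e l.
have [|b [eb bmin bc]] := IH c'.1 _ c' erefl; first by rewrite -cg.
exists b; split=> //; first by rewrite eb.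
by right; case: bc => [->//|/rlex_lt_trans]; apply.
Qed.

(** If no small divisor witnessed the non-minimality of c, then c would be
    standard; so is the minimum of its fibre, and uniqueness would identify c
    with that minimum. *)
Lemma nonmin_small c : nonminimal c ->
  exists c' b, [/\ c = bimon_mul c' b, small_shape b & nonminimal b].
Proof.
move=> [c1 [e l]]; apply: boolp.contrapT => none.
have cs : standard c.
  by apply: locmin_std => c' b cE bs bn; apply: none; exists c', b.
have [b [eb /min_locmin/locmin_std bs bc1]] := phi_mon_min c1.
have bc : b = c by apply: std_uniq; rewrite ?eb.
move: (yx_lt_phi_mon e l) bc1; rewrite bc => l1 [e1|l2].
  by rewrite e1 in l1; exact: rlex_lt_irr l1.
exact: rlex_lt_irr (rlex_lt_trans l1 l2).
Qed.

End Toric.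

(** * The semigroup of the symbolic Rees algebra *)

Section OutsideDegree.
Variable n : nat.
Implicit Types (Z U : {set 'I_n}) (v : 'X_{1..n}).

(** The degree in the variables outside Z.  For |Z| = d - 1 these are the
    variables generating a minimal prime of the squarefree Veronese ideal. *)
Definition odeg Z v := \sum_(i | i \notin Z) v i.

Lemma odegD Z v v' : odeg Z (v + v')%MM = odeg Z v + odeg Z v'.
Proof. by rewrite /odeg -big_split; apply: eq_bigr => i _; rewrite mnmDE. Qed.

Lemma odeg_ge Z v i : i \notin Z -> v i <= odeg Z v.
Proof. by move=> iZ; rewrite /odeg (bigD1 i) //= leq_addr. Qed.

Lemma odeg_supp Z v : msupport v \subset Z -> odeg Z v = 0.
Proof.
move/fintype.subsetP=> vZ; rewrite /odeg big1 // => i iZ.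
by apply/eqP; rewrite -leqn0 leqNgt; apply: contra iZ => vi; apply: vZ; rewrite inE.
Qed.

Lemma mdeg_odeg Z v : mdeg v = \sum_(i in Z) v i + odeg Z v.
Proof. by rewrite mdegE (bigID (mem Z)). Qed.

Lemma odeg_U Z i : odeg Z U_(i)%MM = (i \notin Z).
Proof.
case: (boolP (i \in Z)) => iZ; last first.
  rewrite /odeg (bigD1 i) //= mnm1E eqxx big1 // => j /andP[_ /negbTE ji].
  by rewrite mnm1E eq_sym ji.
rewrite odeg_supp //; apply/fintype.subsetP=> j.
by rewrite inE mnm1E lt0b => /eqP <-.
Qed.

(** (v, k) satisfies the inequalities that characterize the monomials v t^k of
    the symbolic Rees algebra, one for each associated prime. *)
Definition symbolic_mon d (a : 'X_{1..n} * nat) : Prop :=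
  forall Z, #|Z|.+1 = d -> a.2 <= odeg Z a.1.

Variable d : nat.
Hypothesis d_range : 1 <= d <= n.

Lemma symb_supp a : symbolic_mon d a -> 0 < a.2 -> d <= #|msupport a.1|.
Proof.
move=> sa a0; rewrite leqNgt; apply/negP=> h.
have [|Z sZ cZ] := @super_card_ex _ (msupport a.1) d.-1; first by lia.
have := sa Z; rewrite (odeg_supp sZ) cZ; lia.
Qed.

(** Choose Z inside the support: the variables of Z contribute at least d - 1 to
    the degree, those outside at least a.2. *)
Lemma symb_mdeg a : symbolic_mon d a -> 0 < a.2 -> a.2 + d <= (mdeg a.1).+1.
Proof.
move=> sa a0; have [|Z sZ cZ] := @sub_card_ex _ (msupport a.1) d.-1.
  by have := symb_supp sa a0; lia.
have := sa Z; rewrite cZ (mdeg_odeg Z).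
suff : #|Z| <= \sum_(i in Z) a.1 i by lia.
rewrite -sum1_card; apply: leq_sum => i /(fintype.subsetP sZ).
by rewrite inE.
Qed.

Lemma symbD a b : symbolic_mon d a -> symbolic_mon d b ->
  symbolic_mon d ((a.1 + b.1)%MM, a.2 + b.2).
Proof. by move=> sa sb Z cZ; rewrite /= odegD leq_add ?sa ?sb. Qed.

(** A degree count: by [symb_mdeg] the degrees of two factors of positive
    t-degree add up to d - 1 more than that of a generator (and for d = 1 a
    generator has t-degree one), while a factor in S must be trivial. *)
Lemma gen_indecomposable U a b : is_gen d U -> symbolic_mon d a -> symbolic_mon d b ->
    gen_mon d U = ((a.1 + b.1)%MM, a.2 + b.2) ->
  a = gen_mon d U \/ b = gen_mon d U.
Proof.
move=> gU sa sb e; have e2 : #|U|.+1 - d = a.2 + b.2 := congr1 snd e.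
have eU : #|U| = mdeg a.1 + mdeg b.1.
  by rewrite -mdegD -[(_ + _)%MM](congr1 fst e) mdeg_mesym1.
have [dU d1] : d <= #|U| /\ (d == 1) ==> (#|U| == 1) by apply/andP.
have zero (x y : 'X_{1..n} * nat) : symbolic_mon d y -> x.2 = 0 -> 0 < y.2 ->
    mdeg x.1 + mdeg y.1 = #|U| -> y.2 = #|U|.+1 - d -> x.1 = 0%MM.
  move=> sy x0 y0 exy ey; apply/eqP; rewrite -mdeg_eq0.
  by have := symb_mdeg sy y0; lia.
case: (posnP a.2) => a0; [|case: (posnP b.2) => b0].
- have az : a.1 = 0%MM by apply: (zero a b) => //; lia.
  by right; rewrite e a0 az add0m add0n -surjective_pairing.
- have bz : b.1 = 0%MM by apply: (zero b a) => //; lia.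
  by left; rewrite e b0 bz addm0 addn0 -surjective_pairing.
- have ma := symb_mdeg sa a0; have mb := symb_mdeg sb b0.
  by exfalso; move: d1; case: (eqVneq d 1) => [d1 /eqP|d1 _]; lia.
Qed.

(** Removing the full support U with q = |U| - d + 1.  A given Z may miss more
    than q elements of U, so the inequality for Z itself is too weak.  Instead
    keep only q elements B of U outside Z and apply the hypothesis to U minus B,
    which has d - 1 elements: outside it v lives on B only. *)
Lemma symb_exchange v k : symbolic_mon d (v, k) -> 0 < k -> #|msupport v|.+1 - d <= k ->
  symbolic_mon d ((v - mesym1 (msupport v))%MM, k - (#|msupport v|.+1 - d)).
Proof.
move=> sv k0 sk Z cZ /=; set U := msupport v.
have dU : d <= #|U| := symb_supp sv k0.
have [|B Bs Bc] := @sub_card_ex _ (U :\: Z) (#|U|.+1 - d).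
  have := cardsID Z U; have := subset_leq_card (finset.subsetIr U Z); lia.
have BU : B \subset U by apply: fintype.subset_trans Bs (finset.subsetDl _ _).
have := sv (U :\: B).
have := cardsID B U; rewrite (finset.setIidPr BU) Bc => cUB.
rewrite leq_subLR => /(_ _)/leq_trans; apply; first by lia.
rewrite /= -Bc -sum1_card /odeg (bigID (mem B)) /= [X in _ + X]big1; last first.
  move=> i /andP[iUB iB]; apply/eqP; rewrite -leqn0 leqNgt.
  by apply: contra iUB => vi; rewrite !inE iB.
have e1 i : (i \notin U :\: B) && (i \in B) = (i \in B).
  by rewrite !inE; case: (i \in B); rewrite ?andbF.
have e2 i : (i \notin Z) && (i \in B) = (i \in B).
  rewrite andbC; case: (boolP (i \in B)) => // /(fintype.subsetP Bs).
  by rewrite inE => /andP[].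
rewrite addn0 (eq_bigl _ _ e1) [X in _ <= _ + X](bigID (mem B)) /= (eq_bigl _ _ e2).
rewrite addnA -big_split /=; apply: leq_trans (leq_addr _ _).
apply: leq_sum => i iB; rewrite mnmBE mesym1_in; case: (i \in _) => //=; lia.
Qed.

End OutsideDegree.

Local Open Scope classical_set_scope.
Local Open Scope ring_scope.

(** * Generated ideals and subalgebras *)

Lemma ideal_gen_ideal (R : comNzRingType) (G : set R) : is_ideal (ideal_gen G).
Proof.
split.
- by move=> I [[I0 _ _] _].
- by move=> a b Ga Gb I IG; case: (IG) => -[_ ID _] _; apply: ID; [exact: Ga|exact: Gb].
- by move=> r a Ga I IG; case: (IG) => -[_ _ IM] _; apply: IM; exact: Ga.
Qed.

Lemma ideal_sum (R : comNzRingType) (T : eqType) (J : set R) (r : seq T)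
    (F : T -> R) :
  is_ideal J -> (forall x, x \in r -> J (F x)) -> J (\sum_(x <- r) F x).
Proof.
move=> [J0 JD _]; elim: r => [|x r IH] h; first by rewrite big_nil.
rewrite big_cons; apply: JD; first by apply: h; rewrite mem_head.
by apply: IH => y yr; apply: h; rewrite inE yr orbT.
Qed.

Lemma algebra_gen_subalgebra (R : comNzRingType) (V : set {poly R}) :
  is_subalgebra (algebra_gen V).
Proof.
split.
- by move=> c B [[BC _ _] _]; exact: BC.
- by move=> f g fV gV B BV; case: (BV) => -[_ BD _] _; apply: BD; [exact: fV|exact: gV].
- by move=> f g fV gV B BV; case: (BV) => -[_ _ BM] _; apply: BM; [exact: fV|exact: gV].
Qed.

(** * Monomials of S[t] *)

Section XtMonomials.
Variables (K : fieldType) (n : nat).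
Implicit Types a b : 'X_{1..n} * nat.

Lemma xt_monM a b : xt_mon K a * xt_mon K b = xt_mon K ((a.1 + b.1)%MM, (a.2 + b.2)%N).
Proof. by rewrite /xt_mon -scalerAl -scalerAr scalerA -exprD -mpolyXD. Qed.

Lemma xt_mon0 : xt_mon K (0%MM, 0%N) = 1 :> {poly {mpoly K[n]}}.
Proof. by rewrite /xt_mon /= mpolyX0 expr0 scale1r. Qed.

Lemma xt_monX a k : xt_mon K a ^+ k = xt_mon K ((a.1 *+ k)%MM, (a.2 * k)%N).
Proof.
elim: k => [|k IH]; first by rewrite expr0 mulm0n muln0 xt_mon0.
by rewrite exprS IH xt_monM mulmS mulnS.
Qed.

Lemma xt_mon_prod (I : Type) (r : seq I) (F : I -> 'X_{1..n} * nat) :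
  \prod_(i <- r) xt_mon K (F i) =
    xt_mon K ((\sum_(i <- r) (F i).1)%MM, (\sum_(i <- r) (F i).2)%N).
Proof.
elim: r => [|i r IH]; first by rewrite !big_nil xt_mon0.
by rewrite !big_cons IH xt_monM.
Qed.

Lemma coef_xt_mon a v k : (xt_mon K a)`_k@_v = (a == (v, k))%:R.
Proof.
rewrite coefZ coefXn mulr_natr mcoeffMn mcoeffX -mulrnA mulnb.
by rewrite [k == _]eq_sym; case: a => x y; rewrite xpair_eqE.
Qed.

Lemma xt_mon_inj : injective (@xt_mon K n).
Proof.
move=> a b /(congr1 (fun F : {poly {mpoly K[n]}} => F`_b.2@_b.1)); rewrite !coef_xt_mon.
rewrite -surjective_pairing eqxx; case: eqP => // _ /eqP.
by rewrite eq_sym oner_eq0.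
Qed.

End XtMonomials.

(** * Symbolic powers of the squarefree Veronese ideal *)

(** The lowest nonzero coefficient of q reappears in p q, multiplied by the
    constant term of p. *)
Lemma low_coef_cancel (R : idomainType) (p q : {poly R}) k : p`_0 != 0 ->
  (forall j, (j < k)%N -> (p * q)`_j = 0) -> forall j, (j < k)%N -> q`_j = 0.
Proof.
move=> p0 pq; elim/ltn_ind=> j IH jk.
have := pq j jk; rewrite coefM big_ord_recl subn0 big1 => [|i _].
  by rewrite addr0 => /eqP; rewrite mulf_eq0 (negbTE p0) => /eqP.
have ji : (j - lift ord0 i < j)%N by rewrite lift0; have := ltn_ord i; lia.
by rewrite (IH _ ji (ltn_trans ji jk)) mulr0.
Qed.

Section SymbolicPowers.
Variables (K : fieldType) (n : nat).
Local Notation S := {mpoly K[n]}.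
Implicit Types (Z : {set 'I_n}) (f g : S).

Lemma mcoeffM_neq0 f g v : (f * g)@_v != 0 ->
  exists v1 v2, [/\ f@_v1 != 0, g@_v2 != 0 & v = (v1 + v2)%MM].
Proof.
rewrite -mcoeff_msupp => /msuppM_le/allpairsP[[v1 v2] /= [h1 h2 ->]].
by exists v1, v2; rewrite -!mcoeff_msupp.
Qed.

Definition marked_var Z (i : 'I_n) : 'X_{1..n} * nat :=
  (U_(i)%MM, nat_of_bool (i \notin Z)).
(** The K-algebra map multiplying each variable outside Z by an auxiliary
    variable, which therefore records the degree in these variables. *)
Definition marked Z : S -> {poly S} :=
  mmap (polyC \o @mpolyC n K) (fun i => xt_mon K (marked_var Z i)).

Lemma markedM Z f g : marked Z (f * g) = marked Z f * marked Z g.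
Proof. exact: rmorphM. Qed.

Lemma coef_marked Z f k v : (marked Z f)`_k@_v = f@_v *+ (odeg Z v == k).
Proof.
rewrite /marked /mmap.
have h1 u : mmap1 (fun i => xt_mon K (marked_var Z i)) u = xt_mon K (u, odeg Z u).
  rewrite /mmap1; under eq_bigr do rewrite xt_monX.
  rewrite xt_mon_prod /=; congr (xt_mon K (_, _)); first by rewrite -multinomUE_id.
  rewrite /odeg [RHS]big_mkcond /=; apply: eq_bigr => i _.
  by case: (i \notin Z); rewrite ?mul1n ?mul0n.
rewrite coef_sum raddf_sum /=; under eq_bigr => u _.
  rewrite h1 coefCM mcoeffCM coef_xt_mon xpair_eqE; over.
case: (boolP (v \in msupp f)) => vf; last first.
  rewrite (memN_msupp_eq0 vf) mul0rn big1_seq // => u /andP[_ uf].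
  case: eqP => [e|_]; last by rewrite mulr0.
  by rewrite -e uf in vf.
rewrite (bigD1_seq v) ?msupp_uniq //= eqxx big1 => [|u /negbTE ->].
  by rewrite addr0 mulr_natr.
by rewrite mulr0.
Qed.

(** The k-th power of the prime generated by the variables outside Z, described
    by its monomials. *)
Definition ord_ge Z k : set S := [set f | forall v, f@_v != 0 -> (k <= odeg Z v)%N].

Lemma ord_ge_marked Z k f : ord_ge Z k f <-> forall j, (j < k)%N -> (marked Z f)`_j = 0.
Proof.
split=> [fk j jk|fk v fv].
  apply/mpolyP => v; rewrite coef_marked mcoeff0.
  case: eqP => [e|//]; rewrite mulr1n; apply/eqP; apply: contraTT jk => fv.
  by rewrite -leqNgt -e; exact: fk.
rewrite leqNgt; apply: contra fv => /fk/mpolyP/(_ v).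
by rewrite coef_marked eqxx mcoeff0 mulr1n => ->.
Qed.

Lemma ord_ge_ideal Z k : is_ideal (ord_ge Z k).
Proof.
split.
- by move=> v; rewrite mcoeff0 eqxx.
- move=> a b ak bk v; rewrite mcoeffD => abv.
  case: (eqVneq a@_v 0) => [av|]; [apply: bk|exact: ak].
  by apply: contra_neq abv => ->; rewrite av addr0.
- move=> r a ak v /mcoeffM_neq0[v1 [v2 [_ av2 ->]]].
  by rewrite odegD; apply: leq_trans (ak _ av2) (leq_addl _ _).
Qed.

Lemma ord_geM Z j k f g : ord_ge Z j f -> ord_ge Z k g -> ord_ge Z (j + k) (f * g).
Proof.
by move=> fj gk v /mcoeffM_neq0[v1 [v2 [/fj h1 /gk h2 ->]]]; rewrite odegD leq_add.
Qed.

(** Powers of a prime generated by variables are primary. *)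
Lemma ord_ge_cancel Z k f g : ~ ord_ge Z 1 f -> ord_ge Z k (f * g) -> ord_ge Z k g.
Proof.
move=> f0 /ord_ge_marked fgk; apply/ord_ge_marked; rewrite markedM in fgk.
apply: low_coef_cancel fgk; apply/negP=> /eqP e.
by case: f0; apply/ord_ge_marked; case.
Qed.

Lemma ord_ge1_prime Z : is_prime_ideal (ord_ge Z 1).
Proof.
split; first exact: ord_ge_ideal.
- move=> /(_ 0%MM); rewrite mcoeff1 eqxx oner_eq0 => /(_ isT).
  by rewrite odeg_supp //; apply/fintype.subsetP=> i; rewrite inE mnm0E.
- move=> f g fg; case: (boolp.pselect (ord_ge Z 1 f)); first by left.
  by move=> /ord_ge_cancel/(_ fg); right.
Qed.

Lemma ord_ge_mon Z k v : ord_ge Z k 'X_[v] <-> (k <= odeg Z v)%N.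
Proof.
split=> [|kv v']; first by apply; rewrite mcoeffX eqxx oner_eq0.
by rewrite mcoeffX; case: (eqVneq v v') => [<-|]; rewrite ?eqxx.
Qed.

Variable d : nat.
Hypothesis d_range : (1 <= d <= n)%N.
Local Notation I := (sqfree_veronese K n d).

Lemma veronese_ord_ge Z : #|Z|.+1 = d -> I `<=` ord_ge Z 1.
Proof.
move=> cZ; apply: smallest_sub; first exact: ord_ge_ideal.
move=> _ [v [+ ->]]; rewrite mecharP => /existsP[U /andP[/eqP -> /eqP cU]].
apply/ord_ge_mon; have /subsetPn[i iU iZ] : ~~ (U \subset Z).
  by apply/negP=> /subset_leq_card; rewrite cU -cZ ltnn.
by apply: leq_trans (odeg_ge _ iZ); rewrite mesym1_in iU.
Qed.

Lemma veronese_ideal : is_ideal I.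
Proof. exact: ideal_gen_ideal. Qed.

Lemma mechar_mesym1 (U : {set 'I_n}) : mechar #|U| (mesym1 U).
Proof. by rewrite mecharP; apply/existsP; exists U; rewrite !eqxx. Qed.

Lemma veronese_mon v : (d <= #|msupport v|)%N -> I 'X_[v].
Proof.
move=> /sub_card_ex[U Us cU].
have Uv : (mesym1 U <= v)%MM.
  apply/mnm_lepP=> i; rewrite mesym1_in.
  by case: (boolP (i \in U)) => // /(fintype.subsetP Us); rewrite inE.
rewrite -(submK Uv) mpolyXD; have [_ _ IM] := veronese_ideal; apply: IM.
by apply: sub_gen_smallest; exists (mesym1 U); rewrite -cU mechar_mesym1.
Qed.

Lemma veronese_supp f : (forall v, f@_v != 0 -> (d <= #|msupport v|)%N) -> I f.
Proof.
move=> h; rewrite [f]mpolyE; apply: ideal_sum; first exact: veronese_ideal.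
move=> v; rewrite mcoeff_msupp => /h/veronese_mon Iv.
by rewrite -mul_mpolyC; have [_ _ IM] := veronese_ideal; apply: IM.
Qed.

Lemma ideal_pow_ideal k : is_ideal (ideal_pow I k).
Proof. by case: k => [|k]; [split | exact: ideal_gen_ideal]. Qed.

Lemma pow_ord_ge Z k : #|Z|.+1 = d -> ideal_pow I k `<=` ord_ge Z k.
Proof.
move=> cZ; elim: k => [|k IH]; first by move=> f _ v _.
apply: smallest_sub; first exact: ord_ge_ideal.
move=> _ [a [b [Ia Ib ->]]]; rewrite -add1n; apply: ord_geM; last exact: IH.
exact: veronese_ord_ge Ia.
Qed.

(** This prime is the annihilator of the class of the product of the variables
    of Z. *)
Lemma ord_ge1_ass Z : #|Z|.+1 = d -> Ass I (ord_ge Z 1).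
Proof.
move=> cZ; split; first exact: ord_ge1_prime.
exists 'X_[mesym1 Z]; apply/seteqP; split=> r /= hr; last first.
  have /ord_ge_cancel : ~ ord_ge Z 1 'X_[mesym1 Z : 'X_{1..n}].
    move/ord_ge_mon; rewrite odeg_supp //.
    by apply/fintype.subsetP=> i; rewrite inE mesym1_in lt0b.
  by apply; rewrite mulrC; exact: veronese_ord_ge hr.
apply: veronese_supp => _ /mcoeffM_neq0[v [v2 [rv + ->]]].
rewrite mcoeffX; case: (eqVneq _ v2) => [<- _|]; last by rewrite eqxx.
have : (0 < odeg Z v)%N by exact: hr.
rewrite lt0n sum_nat_eq0 => /forallPn[i]; rewrite negb_imply -lt0n => /andP[iZ vi].
have <- : #|i |: Z| = d by rewrite cardsU1 iZ.
apply: subset_leq_card; apply/fintype.subsetP=> l; rewrite !inE mnmDE mesym1_in.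
by case/orP => [/eqP ->|->]; lia.
Qed.

(** Clearing the denominator outside the prime costs nothing, because powers of
    that prime are primary. *)
Lemma symbolic_ord_ge Z k : #|Z|.+1 = d -> symbolic_pow I k `<=` ord_ge Z k.
Proof.
move=> cZ f /(_ _ (ord_ge1_ass cZ)) [s [sZ /(pow_ord_ge cZ)]].
exact: ord_ge_cancel.
Qed.

Lemma symbolic_rees_symb F a : symbolic_rees I F -> F`_a.2@_a.1 != 0 ->
  symbolic_mon d a.
Proof. by move=> AF Fa Z cZ; exact: (symbolic_ord_ge cZ (AF a.2)). Qed.

(** The ideal has no embedded primes: if P is the annihilator of the class of a,
    then a has a monomial with fewer than d variables, and enlarging its support
    to Z puts P inside the prime generated by the variables outside Z. *)
Lemma ass_vars P : Ass I P ->
  exists2 Z : {set 'I_n}, #|Z|.+1 = d & forall i, i \in Z -> ~ P 'X_i.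
Proof.
case=> -[_ P1 _] [a Pa].
have [v [av vd]] : exists v, a@_v != 0 /\ (#|msupport v| < d)%N.
  apply: boolp.contrapT => none; apply: P1; rewrite Pa /= mul1r.
  apply: veronese_supp => v av; rewrite leqNgt; apply/negP=> vd.
  by apply: none; exists v.
have [|Z vZ cZ] := @super_card_ex _ (msupport v) d.-1; first by lia.
have {}cZ : #|Z|.+1 = d by lia.
exists Z => // i iZ; rewrite Pa /= => /(veronese_ord_ge cZ).
have [_ _ pZ] := ord_ge1_prime Z; case/pZ.
  by move/ord_ge_mon; rewrite odeg_U iZ.
by move/(_ _ av); rewrite odeg_supp.
Qed.

Lemma prime_mon (P : set S) (v : 'X_{1..n}) :
    is_prime_ideal P -> (forall i, (0 < v i)%N -> ~ P 'X_i) ->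
  ~ P 'X_[v].
Proof.
case=> _ P1 PM; move: {2}(mdeg v) (erefl (mdeg v)) => k.
elim: k v => [|k IH] v /eqP; first by rewrite mdeg_eq0 => /eqP ->; rewrite mpolyX0.
move=> vk vP; have [i vi] : exists i, (0 < v i)%N by apply: mdeg_gt0; rewrite (eqP vk).
have vE : v = (U_(i) + (v - U_(i)))%MM by rewrite addmC submK // mnm1_le.
rewrite vE mpolyXD => /PM[|]; first exact: vP.
apply: IH; first by move: vk; rewrite {1}vE mdegD mdeg1 => /eqP[].
by move=> j vj; apply: vP; move: vj; rewrite mnmBE; lia.
Qed.

(** Each x_i with i in B, multiplied by the product over Z, is a squarefree
    monomial of degree d. *)
Lemma pow_disjoint Z (B : {set 'I_n}) :
    #|Z|.+1 = d -> (forall i, i \in B -> i \notin Z) ->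
  ideal_pow I #|B| 'X_[mesym1 B + mesym1 Z *+ #|B|].
Proof.
move=> cZ; move: {2}#|B| (erefl #|B|) => k; elim: k B => [|k IH] B cB BZ.
  by rewrite cB.
have [i iB] : exists i, i \in B by apply/card_gt0P; rewrite cB.
have cB' : #|B :\ i| = k by move: (cardsD1 i B); rewrite iB cB => -[].
have {IH} := IH (B :\ i) cB'; rewrite cB' cB => IH.
apply: sub_gen_smallest; exists 'X_[mesym1 (i |: Z)],
  'X_[mesym1 (B :\ i) + mesym1 Z *+ k].
split.
- have <- : #|i |: Z| = d by rewrite cardsU1 BZ.
  by apply: sub_gen_smallest; exists (mesym1 (i |: Z)); rewrite mechar_mesym1.
- by apply: IH => j; rewrite !inE => /andP[_ /BZ].
- rewrite -mpolyXD; congr mpolyX; apply/mnmP=> l.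
  rewrite !mnmDE !mulmnE !mesym1_in !inE mulnS.
  by case: (eqVneq l i) => [->|_]; rewrite ?iB ?(negbTE (BZ _ iB)) //=; lia.
Qed.

(** In the localization at an associated prime the variables of some Z are
    units, and U has at least q = |U| - d + 1 elements outside Z, each of them
    then lying in the ideal; the product of these is in its q-th power. *)
Lemma gen_symbolic U : is_gen d U -> symbolic_rees I (xt_mon K (gen_mon d U)).
Proof.
move=> /andP[dU _] k P PA; have [[_ P1 _] _] := PA.
case: (eqVneq k (#|U|.+1 - d)%N) => [->|kU]; last first.
  exists 1; split=> //; rewrite coefZ coefXn (negbTE kU) !mulr0.
  by have [] := ideal_pow_ideal k.
rewrite coefZ coefXn eqxx mulr1 /=; have [Z cZ PZ] := ass_vars PA.
have [|B Bs cB] := @sub_card_ex _ (U :\: Z) (#|U|.+1 - d).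
  have := cardsID Z U; have := subset_leq_card (finset.subsetIr U Z); lia.
exists 'X_[mesym1 Z *+ #|B|]; split.
  apply: prime_mon; first by case: PA.
  by move=> i; rewrite mulmnE mesym1_in; case: (boolP (i \in Z)) => // /PZ.
have -> : mesym1 U = (mesym1 (U :\: B) + mesym1 B)%MM.
  apply/mnmP=> i; rewrite mnmDE !mesym1_in !inE.
  case: (boolP (i \in B)) => [/(fintype.subsetP Bs)|_]; last by rewrite addn0.
  by rewrite inE => /andP[_ ->].
rewrite -mpolyXD addmC -addmA mpolyXD -cB.
have [_ _ IM] := ideal_pow_ideal #|B|; apply: IM; apply: pow_disjoint => // i.
by move/(fintype.subsetP Bs); rewrite inE => /andP[].
Qed.

Definition veronese_gens : set {poly S} :=
  [set xt_mon K (gen_mon d U) | U in [set U | is_gen d U]].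

Lemma coefpM_neq0 (F G : {poly S}) k v : (F * G)`_k@_v != 0 ->
  exists a b, [/\ F`_a.2@_a.1 != 0, G`_b.2@_b.1 != 0 &
                  (v, k) = ((a.1 + b.1)%MM, (a.2 + b.2)%N)].
Proof.
rewrite coefM raddf_sum /= => nz.
have [i /mcoeffM_neq0[v1 [v2 [h1 h2 ->]]]] :
    exists i : 'I_k.+1, (F`_i * G`_(k - i))@_v != 0.
  apply/existsP; apply: contraNT nz; rewrite negb_exists => /forallP h.
  by rewrite big1 // => i _; apply/eqP; move: (h i); rewrite negbK.
by exists (v1, i : nat), (v2, (k - i)%N); rewrite /= subnKC // -ltnS.
Qed.

(** Any subsemigroup of exponents containing all those of S spans an
    S-subalgebra. *)
Lemma supp_subalgebra (Q : 'X_{1..n} * nat -> Prop) :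
    (forall v, Q (v, 0%N)) ->
    (forall a b, Q a -> Q b -> Q ((a.1 + b.1)%MM, (a.2 + b.2)%N)) ->
  is_subalgebra [set F : {poly S} | forall a, F`_a.2@_a.1 != 0 -> Q a].
Proof.
move=> Q0 QD; split.
- move=> c [v [|k]] /=; first by move=> _; exact: Q0.
  by rewrite coefC mcoeff0 eqxx.
- move=> F G QF QG a; rewrite coefD mcoeffD => nz.
  case: (eqVneq F`_a.2@_a.1 0) => [Fa|]; [apply: QG|exact: QF].
  by apply: contra_neq nz => ->; rewrite Fa addr0.
- move=> F G QF QG [v k] /coefpM_neq0[a [b [/QF Qa /QG Qb ->]]]; exact: QD.
Qed.

(** Split off one generator at a time: the full support of v if its t-degree
    does not exceed k, and otherwise a part of the support with t-degree exactly
    k.  For d = 1 a single variable is split off. *)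
Lemma symb_generated a : symbolic_mon d a -> algebra_gen veronese_gens (xt_mon K a).
Proof.
case: a => v k; elim/ltn_ind: k v => k IH v sv.
have [AC _ AM] := algebra_gen_subalgebra veronese_gens.
have AX u : algebra_gen veronese_gens (xt_mon K (u, 0%N)).
  by rewrite /xt_mon /= expr0 alg_polyC; exact: AC.
case: (posnP k) => [->//|k0].
have peel U : is_gen d U -> U \subset msupport v -> (#|U|.+1 - d <= k)%N ->
    symbolic_mon d ((v - mesym1 U)%MM, (k - (#|U|.+1 - d))%N) ->
    algebra_gen veronese_gens (xt_mon K (v, k)).
  move=> gU /fintype.subsetP Uv Uk s.
  have -> : xt_mon K (v, k) = xt_mon K (gen_mon d U) *
      xt_mon K ((v - mesym1 U)%MM, (k - (#|U|.+1 - d))%N).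
    rewrite xt_monM /= addmC submK ?subnKC //; apply/mnm_lepP=> i.
    by rewrite mesym1_in; case: (boolP (i \in U)) => // /Uv; rewrite inE.
  apply: AM; first by apply: sub_gen_smallest; exists U.
  by apply: IH => //; case/andP: gU => dU _; lia.
have sd : (d <= #|msupport v|)%N := symb_supp d_range sv k0.
case: (eqVneq d 1%N) => d1.
  have [i iv] : exists i, i \in msupport v by apply/card_gt0P; lia.
  have vi : (0 < v i)%N by rewrite inE in iv.
  apply: (peel [set i]%SET); rewrite ?/is_gen ?cards1 ?d1 ?finset.sub1set //.
  move=> Z [cZ] /=; have Z0 : Z = finset.set0 by apply/cards0_eq.
  have := sv Z; rewrite cZ d1 => /(_ erefl) /=.
  have {1}-> : v = (mesym1 [set i]%SET + (v - mesym1 [set i]%SET))%MM.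
    by rewrite mesym1_set1 addmC submK // mnm1_le.
  rewrite odegD mesym1_set1 odeg_U Z0 inE /=; lia.
case: (ltnP k (#|msupport v|.+1 - d)) => h; last first.
  apply: (peel (msupport v)) => //; first by rewrite /is_gen sd (negbTE d1).
  exact: symb_exchange.
have [|U Us cU] := @sub_card_ex _ (msupport v) (k + d.-1); first by lia.
apply: (peel U) => //; rewrite ?cU ?/is_gen ?(negbTE d1); try lia.
by move=> Z _ /=; lia.
Qed.

Lemma symb_span (F : {poly S}) :
  (forall a, F`_a.2@_a.1 != 0 -> symbolic_mon d a) -> algebra_gen veronese_gens F.
Proof.
move=> sF; have [AC AD AM] := algebra_gen_subalgebra veronese_gens.
have Asum (T : eqType) (r : seq T) (G : T -> {poly S}) :
    (forall x, x \in r -> algebra_gen veronese_gens (G x)) ->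
    algebra_gen veronese_gens (\sum_(x <- r) G x).
  elim: r => [|x r IH] h; first by rewrite big_nil; exact: (AC 0).
  rewrite big_cons; apply: AD; first by apply: h; rewrite mem_head.
  by apply: IH => y yr; apply: h; rewrite inE yr orbT.
rewrite -[F]coefK poly_def; apply: (Asum) => i _.
rewrite [F`_i]mpolyE scaler_suml; apply: Asum => v.
rewrite mcoeff_msupp => /(sF (v, val i))/symb_generated Ai.
by rewrite -mul_mpolyC -scalerA -mul_polyC; apply: AM; [exact: AC|exact: Ai].
Qed.

Section MinimalGenerators.
Variables (m : nat) (w : 'I_m -> 'X_{1..n} * nat).
Hypothesis w_min : is_minimal_generating_set (symbolic_rees I)
  [set xt_mon K (w i) | i in [set: 'I_m]].

(** If an indecomposable monomial were missing from the generators, they would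
    all lie in the subalgebra spanned by the other monomials. *)
Lemma gen_in_w U : is_gen d U -> exists j, w j = gen_mon d U.
Proof.
move=> gU; apply: boolp.contrapT => none; have [wA _] := w_min.
pose Q a := symbolic_mon d a /\ a <> gen_mon d U.
have Qsub : is_subalgebra [set F : {poly S} | forall a, F`_a.2@_a.1 != 0 -> Q a].
  apply: supp_subalgebra => [v|a b [sa na] [sb nb]].
    by split=> // -[_] /esym/eqP; rewrite subn_eq0 ltnNge; case/andP: gU => ->.
  split; first exact: symbD.
  by move=> /esym/(gen_indecomposable d_range gU sa sb)[].
have : symbolic_rees I `<=` [set F : {poly S} | forall a, F`_a.2@_a.1 != 0 -> Q a].
  rewrite -wA; apply: smallest_sub => // F Fw a Fa.
  have AF : symbolic_rees I F by rewrite -wA; exact: sub_gen_smallest.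
  split; first exact: symbolic_rees_symb AF Fa.
  case: Fw Fa => j _ <-; rewrite coef_xt_mon -surjective_pairing => wa e.
  apply: none; exists j; rewrite -e; apply/eqP.
  by apply: contraNT wa => /negbTE ->.
move/(_ _ (gen_symbolic gU)) => /(_ (gen_mon d U)).
by rewrite coef_xt_mon -surjective_pairing eqxx oner_eq0 => /(_ isT)[].
Qed.

(** The indecomposable monomials lie among the w_j and already generate, so
    minimality leaves no room for others. *)
Lemma w_in_gen j : exists2 U, is_gen d U & w j = gen_mon d U.
Proof.
have [wA wmin] := w_min.
have gA : algebra_gen veronese_gens = symbolic_rees I.
  apply/seteqP; split=> [|F AF]; last first.
    by apply: symb_span => a; exact: symbolic_rees_symb.
  rewrite -wA; apply: smallest_sub; first exact: algebra_gen_subalgebra.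
  by move=> _ [U gU <-]; rewrite wA; exact: gen_symbolic.
have gw : veronese_gens `<=` [set xt_mon K (w i) | i in [set: 'I_m]].
  by move=> _ [U gU <-]; have [i <-] := gen_in_w gU; exists i.
have : veronese_gens (xt_mon K (w j)) by rewrite (wmin _ gw gA); exists j.
by case=> U gU /xt_mon_inj e; exists U.
Qed.

End MinimalGenerators.

End SymbolicPowers.

(** * The initial ideal of the defining ideal *)

Section InitialIdeal.
Variables (K : fieldType) (n m : nat) (w : 'I_m -> 'X_{1..n} * nat).

Local Notation bimon := ('X_{1..m} * 'X_{1..n})%type.
Local Notation S := {mpoly K[n]}.
Local Notation T := {mpoly S[m]}.
Local Notation phi := (mmap (@polyC S) (fun i => xt_mon K (w i))).
Local Notation phi_mon := (phi_mon w).
Local Notation nonminimal := (nonminimal w).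

Lemma yx_monM (c b : bimon) : yx_mon K c * yx_mon K b = yx_mon K (bimon_mul c b).
Proof. by rewrite /yx_mon -scalerAl -scalerAr scalerA -!mpolyXD. Qed.

Lemma coef_yx_mon (c b : bimon) : (yx_mon K c)@_b.1@_b.2 = (c == b)%:R.
Proof.
rewrite mcoeffZ mcoeffX mulr_natr mcoeffMn mcoeffX -mulrnA mulnb.
by rewrite andbC; case: c b => [x y] [x' y']; rewrite xpair_eqE.
Qed.

Lemma mmap1_xt (g : 'X_{1..m}) :
  mmap1 (fun i => xt_mon K (w i)) g = xt_mon K (phi_mon (g, 0%MM)).
Proof.
rewrite /mmap1; under eq_bigr do rewrite xt_monX.
by rewrite xt_mon_prod /phi_mon /= add0m.
Qed.

Lemma phi_coef (F : T) a : (phi F)`_a.2@_a.1 =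
  \sum_(g <- msupp F) \sum_(f <- msupp F@_g) F@_g@_f * (phi_mon (g, f) == a)%:R.
Proof.
rewrite /mmap coef_sum raddf_sum; apply: eq_bigr => g _ /=.
rewrite mmap1_xt coefCM {1}[F@_g]mpolyE mulr_suml raddf_sum; apply: eq_bigr => f _ /=.
rewrite -scalerAl mcoeffZ; congr (_ * _).
rewrite coefZ coefXn mulrA -mpolyXD mulr_natr mcoeffMn mcoeffX -mulrnA mulnb.
by rewrite [a.2 == _]eq_sym /= add0m; case: a => x y; rewrite xpair_eqE.
Qed.

Lemma phi_yx_mon c : phi (yx_mon K c) = xt_mon K (phi_mon c).
Proof.
rewrite /yx_mon mmapZ mmapX mmap1_xt -[X in X * _ = _](_ : xt_mon K (c.2, 0%N) = _).
  by rewrite xt_monM /= add0m add0n.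
by rewrite /xt_mon /= expr0 alg_polyC.
Qed.

(** The coefficient of the image of F at the image of c is a sum over the
    monomials of F in the fibre of c; it vanishes, so c is not alone there, and
    the others are smaller. *)
Lemma initial_nonmin (F : T) c :
  defining_ideal K w F -> is_initial_monomial F c -> nonminimal c.
Proof.
move=> JF [Fc Fmax]; apply: boolp.contrapT => cmin.
have /eqP := phi_coef F (phi_mon c); rewrite JF coef0 mcoeff0 eq_sym.
have cin : c.1 \in msupp F.
  by rewrite mcoeff_msupp; apply: contra_neq Fc => ->; rewrite mcoeff0.
have cin2 : c.2 \in msupp F@_c.1 by rewrite mcoeff_msupp.
have other b : b != c -> F@_b.1@_b.2 * (phi_mon b == phi_mon c)%:R = 0.
  move=> bc; case: eqP => [e|_]; last by rewrite mulr0.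
  case: (eqVneq F@_b.1@_b.2 0) => [->|Fb]; first by rewrite mul0r.
  case: (Fmax b Fb) => [e'|lt]; first by rewrite e' eqxx in bc.
  by case: cmin; exists b.
rewrite (bigD1_seq c.1) ?msupp_uniq //= (bigD1_seq c.2) ?msupp_uniq //=.
rewrite -surjective_pairing eqxx mulr1 big1_seq => [|f /andP[fc _]]; last first.
  apply: (other (c.1, f)); apply: contra_neq fc => /(congr1 snd) //.
rewrite addr0 big1_seq => [|g /andP[gc _]]; first by rewrite addr0 (negbTE Fc).
rewrite big1_seq // => f _; apply: (other (g, f)).
by apply: contra_neq gc => /(congr1 fst).
Qed.

Lemma yx_lt_neq (b c : bimon) : yx_lt b c -> b != c.
Proof.
move=> l; apply/eqP => e; subst b; case: l => [|[_]]; first exact: rlex_lt_irr.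
by case=> i []; rewrite ltnn.
Qed.

(** The binomial of two monomials in the same fibre lies in J. *)
Lemma nonmin_initial c : nonminimal c ->
  exists F, defining_ideal K w F /\ is_initial_monomial F c.
Proof.
case=> b [e l]; have bc := yx_lt_neq l.
exists (yx_mon K c - yx_mon K b); split.
  by rewrite /defining_ideal /= mmapB !phi_yx_mon e subrr.
split; first by rewrite !mcoeffB !coef_yx_mon eqxx (negbTE bc) subr0 oner_eq0.
move=> x; rewrite !mcoeffB !coef_yx_mon.
case: (eqVneq c x) => [->|_]; first by left.
case: (eqVneq b x) => [<-|_]; first by right.
by rewrite subrr eqxx.
Qed.

Lemma initial_ideal_small :
    (forall c, nonminimal c ->
      exists c' b, [/\ c = bimon_mul c' b, small_shape b & nonminimal b]) ->
  initial_ideal (defining_ideal K w) =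
    ideal_gen [set M | exists c, [/\ nonminimal c, small_shape c & M = yx_mon K c]].
Proof.
move=> cut; apply/seteqP; split; apply: smallest_sub; try exact: ideal_gen_ideal.
- move=> M [F [c [JF Fc ->]]].
  have [c' [b [-> bs bn]]] := cut c (initial_nonmin JF Fc).
  rewrite -yx_monM; have [_ _] := ideal_gen_ideal
    [set M | exists c, [/\ nonminimal c, small_shape c & M = yx_mon K c]]; apply.
  by apply: sub_gen_smallest; exists b.
- move=> M [c [/nonmin_initial[F [JF Fc]] _ ->]].
  by apply: sub_gen_smallest; exists F, c.
Qed.

Lemma small_yx_mon c : small_shape c ->
  [\/ exists i j, yx_mon K c = xvar K m i * yvar K n j,
      exists j k, yx_mon K c = yvar K n j * yvar K n k
    | exists i j k, yx_mon K c = xvar K m i * yvar K n j * yvar K n k].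
Proof.
case=> [[i [j ->]]|[j [k ->]]|[i [j [k ->]]]];
  [constructor 1|constructor 2|constructor 3].
- by exists i, j; rewrite /yx_mon /xvar /yvar mul_mpolyC.
- by exists j, k; rewrite /yx_mon /yvar /= mpolyX0 scale1r mpolyXD.
- by exists i, j, k; rewrite /yx_mon /xvar /yvar /= mpolyXD mul_mpolyC -scalerAl.
Qed.

End InitialIdeal.

Theorem proposition3p7 (K : fieldType) (n d m : nat)
    (w : 'I_m -> 'X_{1..n} * nat) :
  (1 <= d <= n)%N ->
  is_minimal_generating_set (symbolic_rees (sqfree_veronese K n d))
    [set xt_mon K (w i) | i in [set: 'I_m]] ->
  (forall i j : 'I_m, (i < j)%N -> xt_lt (w j) (w i)) ->
  exists G : set {mpoly {mpoly K[n]}[m]},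
    (forall M, G M ->
       [\/ exists i j, M = xvar K m i * yvar K n j,
           exists j k, M = yvar K n j * yvar K n k
         | exists i j k, M = xvar K m i * yvar K n j * yvar K n k]) /\
    initial_ideal (defining_ideal K w) = ideal_gen G.
Proof.
move=> d_range w_min w_sorted; have d_gt0 : (0 < d)%N by case/andP: d_range.
have /boolp.choice[u u_gen] :
    forall j, exists U : {set 'I_n}, is_gen d U /\ w j = gen_mon d U.
  by move=> j; have [U gU e] := w_in_gen d_range w_min j; exists U.
have wE j : w j = gen_mon d (u j) by case: (u_gen j).
exists [set M | exists c, [/\ nonminimal w c, small_shape c & M = yx_mon K c]]; split.
  by move=> M [c [_ sc ->]]; exact: small_yx_mon.
apply: initial_ideal_small => c; apply: (nonmin_small wE _ _ w_sorted d_gt0).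
  by move=> j; case: (u_gen j).
move=> U gU; have [j e] := gen_in_w d_range w_min gU.
by exists j; apply: (@gen_mon_inj n d); rewrite -wE.
Qed.
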